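(* Let $f:\mathbb{R}^n\to\mathbb{R}$ be twice continuously differentiable with Hessian $H(w):=\nabla^2 f(w)$, and let $c,\delta\in(0,1)$. Let $\{w_k\}_{k\ge0}$ be generated by gradient descent $w_{k+1}=w_k-\eta_k\nabla f(w_k)$, where each $\eta_k>0$ is the step size returned by the equality line search at $w_k$ along $-\nabla f(w_k)$ with parameters $c,\delta$, some initial step size $\eta_{k,0}>0$ and a reference value $R_k\ge f(w_k)$. Let $\bar k\in\mathbb{N}$ be such that $f$ satisfies the segment smoothness assumption at $w_k$ for all $k>\bar k$. Assume that $\{w_k\}$ converges to $w^*\in\mathbb{R}^n$. Then for every $\varepsilon>0$ there exists $\hat k>\bar k$ such that $$\eta_k\ \ge\ \frac{2(1-c)\delta}{|\lambda_1(H(w^* ))|+\varepsilon}\qquad\text{for all }k\ge\hat k .$$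
   Context: For a symmetric matrix $A\in\mathbb{R}^{n\times n}$, the eigenvalues are ordered by absolute value, $|\lambda_1(A)|\ge|\lambda_2(A)|\ge\dots\ge|\lambda_n(A)|$. Segment smoothness at $w$. For $\eta>0$ put $w_\eta:=w-\eta\nabla f(w)$ and $$l(w,\eta):=\sup_{\hat\eta\in(0,\eta]}\frac{\|\nabla f(w)-\nabla f(w_{\hat\eta})\|}{\|w-w_{\hat\eta}\|}$$ (with $0/0=0$). The segment smoothness assumption holds at $w$ if there is $\eta_w>0$ with $l(w,\eta_w)<\infty$, where $\eta_w$ is chosen such that $\eta_w\ge\frac{2}{l(w,\eta_w)}$. Equality line search. Inputs: $w_k,d_k\in\mathbb{R}^n$, $c,\delta\in(0,1)$, $\eta_{k,0}>0$, and $R_k\ge f(w_k)$ (here $d_k=-\nabla f(w_k)$). A step size $\eta$ is accepted if $f(w_k+\eta d_k)\le R_k+c\,\eta\,\nabla f(w_k)^Td_k$. If $\eta_{k,0}$ is not accepted, test $\delta\eta_{k,0},\delta^2\eta_{k,0},\dots$ and return the first accepted value. If $\eta_{k,0}$ is accepted, test $\delta^{-1}\eta_{k,0},\delta^{-2}\eta_{k,0},\dots$ until the first value $\delta^{-m}\eta_{k,0}$ that is not accepted, and return $\delta^{-m+1}\eta_{k,0}$. It is understood that the procedure terminates at every iteration (in particular $\nabla f(w_k)\neq0$). *)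

(* Defs.v *)
From HB Require Import structures.
From mathcomp Require Import all_boot all_order all_algebra.
From mathcomp Require Import all_classical all_reals all_analysis.

Set Implicit Arguments.
Unset Strict Implicit.
Unset Printing Implicit Defensive.

Import Order.TTheory GRing.Theory Num.Theory.
Import numFieldNormedType.Exports.

Local Open Scope classical_set_scope.
Local Open Scope ring_scope.

(* The library norm on 'rV[R]_n is the sup norm, hence [dot] and [enorm].
   Topological notions (limits, continuity, differentiability) do not depend
   on this choice and are the library's. *)
Definition dot (R : realType) (n : nat) (u v : 'rV[R]_n) : R :=
  \sum_(i < n) u 0 i * v 0 i.

Definition enorm (R : realType) (n : nat) (u : 'rV[R]_n) : R :=
  Num.sqrt (dot u u).

Definition gradient (R : realType) (n : nat) (f : 'rV[R]_n -> R)
    (w : 'rV[R]_n) : 'rV[R]_n :=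
  \row_(i < n) 'D_(delta_mx 0 i) f w.

Definition hessian (R : realType) (n : nat) (f : 'rV[R]_n -> R)
    (w : 'rV[R]_n) : 'M[R]_n :=
  \matrix_(i < n, j < n) 'D_(delta_mx 0 j) ('D_(delta_mx 0 i) f) w.

Definition twice_continuously_differentiable (R : realType) (n : nat)
    (f : 'rV[R]_n -> R) : Prop :=
  [/\ forall w, differentiable f w,
      forall w, differentiable (gradient f) w
    & continuous (hessian f)].

(* The eigenvalues of A with multiplicity, by decreasing absolute value. They
   exist for every symmetric A (the default value [::] is then not used), and
   the absolute values of the entries do not depend on the choice made. *)
Definition eigenvalues (R : realType) (n : nat) (A : 'M[R]_n) : seq R :=
  xget [::] [set s : seq R |
    char_poly A = \prod_(a <- s) ('X - a%:P) /\
    sorted (fun x y : R => `|y| <= `|x|) s].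

Definition lambda1 (R : realType) (n : nat) (A : 'M[R]_n) : R :=
  head 0 (eigenvalues A).

Definition gd_step (R : realType) (n : nat) (f : 'rV[R]_n -> R)
    (w : 'rV[R]_n) (eta : R) : 'rV[R]_n :=
  w - eta *: gradient f w.

(* The convention 0/0 = 0 is the one of real division. *)
Definition segment_lipschitz (R : realType) (n : nat) (f : 'rV[R]_n -> R)
    (w : 'rV[R]_n) (eta : R) : \bar R :=
  ereal_sup [set ((enorm (gradient f w - gradient f (gd_step f w t)) /
                   enorm (w - gd_step f w t))%:E) | t in `]0, eta] ].

(* Division is that of \bar R, where 2 / 0 = +oo. *)
Definition segment_smooth (R : realType) (n : nat) (f : 'rV[R]_n -> R)
    (w : 'rV[R]_n) : Prop :=
  exists eta : R, [/\ 0 < eta,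
    (segment_lipschitz f w eta < +oo)%E &
    (2%:E / segment_lipschitz f w eta <= eta%:E)%E].

Definition accepted (R : realType) (n : nat) (f : 'rV[R]_n -> R) (c : R)
    (w d : 'rV[R]_n) (Rk eta : R) : Prop :=
  f (w + eta *: d) <= Rk + c * eta * dot (gradient f w) d.

(* The search terminates and returns [eta]. The two disjuncts are the
   backtracking case (eta0 rejected) and the forward-tracking case (eta0
   accepted; delta^-(m+1) * eta0 is the first rejected trial value). *)
Definition equality_line_search (R : realType) (n : nat) (f : 'rV[R]_n -> R)
    (c delta : R) (w d : 'rV[R]_n) (eta0 Rk eta : R) : Prop :=
  (exists j : nat,
     [/\ (0 < j)%N,
         forall i : nat, (i < j)%N -> ~ accepted f c w d Rk (delta ^+ i * eta0),
         accepted f c w d Rk (delta ^+ j * eta0)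
       & eta = delta ^+ j * eta0])
  \/
  (exists m : nat,
     [/\ forall i : nat, (i <= m)%N -> accepted f c w d Rk (delta ^- i * eta0),
         ~ accepted f c w d Rk (delta ^- m.+1 * eta0)
       & eta = delta ^- m * eta0]).

(* Main.v *)
Require Import Defs.
From HB Require Import structures.
From mathcomp Require Import all_boot all_order all_algebra.
From mathcomp Require Import all_classical all_reals all_analysis.
From mathcomp Require Import complex ring lra.
Set Implicit Arguments.
Unset Strict Implicit.
Unset Printing Implicit Defensive.
Import Order.TTheory GRing.Theory Num.Theory.
Import numFieldNormedType.Exports.
Local Open Scope classical_set_scope.
Local Open Scope ring_scope.

(** The rejected trial step [t = eta k / delta] satisfies
    [f (w k - t g) - f (w k) > - c t |g|^2], while a second-order Taylor bound
    gives [f (w k - t g) - f (w k) <= - t |g|^2 + M t^2 |g|^2 / 2], with [M] a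
    bound on the Rayleigh quotients of the Hessian along the segment; hence
    [t > 2 (1 - c) / M]. As [t |g| = |w k.+1 - w k| / delta] tends to [0], the
    segment shrinks to [wstar], and by continuity of the Hessian
    [M = |lambda1 (hessian f wstar)| + eps] is eventually admissible. *)

(** * Spectral bound for real symmetric matrices *)

Lemma char_poly_conj (F : fieldType) (n : nat) (P A : 'M[F]_n) :
  P \in unitmx -> char_poly (invmx P *m A *m P) = char_poly A.
Proof.
move=> Pu; rewrite /char_poly.
have -> : char_poly_mx (invmx P *m A *m P) =
    map_mx polyC (invmx P) *m char_poly_mx A *m map_mx polyC P.
  rewrite /char_poly_mx mulmxBr mulmxBl -!map_mxM; congr (_ - _).
  by rewrite -mulmxA -scalar_mxC mulmxA -map_mxM mulVmx// map_mx1 mul1mx.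
by rewrite !det_mulmx mulrAC -det_mulmx -map_mxM mulVmx// map_mx1 det1 mul1r.
Qed.

Lemma char_poly_diag (F : comNzRingType) (n : nat) (d : 'rV[F]_n) :
  char_poly (diag_mx d) = \prod_(i < n) ('X - (d 0 i)%:P).
Proof.
rewrite char_poly_trig ?diag_mx_is_trig//.
by apply: eq_bigr => i _; rewrite mxE eqxx mulr1n.
Qed.

(** Over [complex R] the matrix is Hermitian, hence unitarily diagonalizable with a real diagonal
    [d]. In the eigenbasis the quadratic form is the sum of the [d 0 i] weighted by squared moduli
    whose total is [dot v v]. *)
Lemma symmetric_spectral (R : realType) (n : nat) (A : 'M[R]_n) : A^T = A ->
  exists2 d : 'rV[R]_n, char_poly A = \prod_(i < n) ('X - (d 0 i)%:P)
    & forall (v : 'rV[R]_n) (M : R), (forall i, d 0 i <= M) ->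
        (v *m A *m v^T) 0 0 <= M * dot v v.
Proof.
move=> Asym; pose tC : {rmorphism R -> complex R} := real_complex R.
pose B : 'M[complex R]_n := map_mx tC A.
have tC_conj (x : R) : (tC x)^* = tC x by rewrite /tC /= /Num.conj /= oppr0.
have Bherm : B \is hermitianmx _ false Num.conj.
  apply/is_hermitianmxP; rewrite expr0 scale1r; apply/matrixP => i j.
  by rewrite !mxE tC_conj -[in LHS]Asym mxE.
have /orthomx_spectralP := hermitian_normalmx Bherm.
set U := spectralmx B; set D := spectral_diag B => BE.
have Uu : U \is unitarymx := spectral_unitarymx B.
pose d : 'rV[R]_n := map_mx (@complex.Re R) D.
have DE : D = map_mx tC d.
  apply/rowP => i; rewrite !mxE.
  (* Each diagonal entry equals its conjugate, so its imaginary part equals its own opposite and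
     vanishes. *)
  have /mxOverP/(_ 0 i) := hermitian_spectral_diag_real Bherm.
  by rewrite -/D => /CrealP; case: (D 0 i) => a b [] /eqP;
     rewrite -subr_eq0 -opprD oppr_eq0 -mulr2n mulrn_eq0 /= => /eqP ->.
exists d.
  apply: (@map_poly_inj _ _ tC).
  rewrite map_char_poly -/B BE char_poly_conj ?unitarymx_unit//.
  rewrite char_poly_diag rmorph_prod; apply: eq_bigr => i _.
  by rewrite rmorphB /= map_polyX map_polyC DE mxE.
move=> v M dM.
(* [u] holds the coordinates of [v] in the eigenbasis; the existential keeps it opaque to later
   rewriting. *)
have [u uE] : exists u, u = map_mx tC v *m map_mx Num.conj U^T by eexists.
have uT : U *m (map_mx tC v)^T = map_mx Num.conj u^T.
  rewrite uE trmx_mul map_mxM -!map_trmx trmxK.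
  congr (_ *m _).
    by apply/matrixP => i j; rewrite !mxE; exact: (esym (conjCK _)).
  by apply/matrixP => i j; rewrite !mxE; exact: (esym (tC_conj _)).
have vv : tC (dot v v) = \sum_i (`|u 0 i| ^+ 2).
  have : map_mx tC v *m (map_mx tC v)^T = u *m map_mx Num.conj u^T.
    by rewrite -uT uE -invmx_unitary// mulmxA mulmxKV ?unitarymx_unit.
  move=> /matrixP /(_ 0 0); rewrite !mxE.
  rewrite /dot rmorph_sum => e.
  transitivity (\sum_j map_mx tC v 0 j * (map_mx tC v)^T j 0).
    by apply: eq_bigr => i _; rewrite !mxE rmorphM.
  by rewrite e; apply: eq_bigr => i _; rewrite !mxE normCK.
have vAv : tC ((v *m A *m v^T) 0 0) = \sum_i tC (d 0 i) * `|u 0 i| ^+ 2.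
  transitivity ((u *m diag_mx D *m map_mx Num.conj u^T) 0 0).
    rewrite -uT uE -invmx_unitary// !mulmxA.
    rewrite -(mulmxA _ (invmx U)) -(mulmxA _ _ U) -BE.
    by rewrite -map_mxM map_trmx -map_mxM [RHS]mxE.
  rewrite mxE; apply: eq_bigr => i _.
  by rewrite mul_mx_diag !mxE normCK [u 0 i * _]mulrC -mulrA DE mxE.
rewrite -lecR -[X in X <= _]/(tC _) -[X in _ <= X]/(tC _) rmorphM vv vAv.
rewrite mulr_sumr ler_sum // => i _.
by rewrite ler_wpM2r ?exprn_ge0 ?normr_ge0// lecR.
Qed.

(** Each [d 0 i] is a root of the characteristic polynomial, so it occurs in the sorted list and its
    absolute value is at most that of the head. *)
Lemma rayleigh_le_lambda1 (R : realType) (n : nat) (A : 'M[R]_n)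
    (v : 'rV[R]_n) : A^T = A ->
  (v *m A *m v^T) 0 0 <= `|lambda1 A| * dot v v.
Proof.
move=> /symmetric_spectral[d dE]; apply => i.
rewrite /lambda1 /eigenvalues; case: xgetP => [s _ [sE s_sorted]|noeig].
  have : d 0 i \in s.
    rewrite -root_prod_XsubC -sE dE (bigD1 i)//= rootM root_XsubC eqxx//.
  case: s s_sorted {sE} => [//|a s] /= s_sorted din.
  rewrite (le_trans (ler_norm _))//.
  move: din; rewrite inE => /predU1P[->//|].
  move: s_sorted; rewrite path_sortedE => [/andP[/allP + _]|y x z xy yz].
    exact.
  exact: le_trans yz xy.
(* The default [[::]] is never taken: sorting the entries of [d] gives an admissible list. *)
exfalso; pose leabs (x y : R) := `|y| <= `|x|.
apply: (noeig (sort leabs [seq d 0 i | i <- enum 'I_n])); split.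
  rewrite (perm_big _ (permEl (perm_sort _ _))) /= big_map big_enum //=.
by apply: sort_sorted => x y; exact: le_total.
Qed.

(** * Mean values, mixed derivatives and Taylor's inequality along lines *)

Lemma is_derive_line (R : realType) (V W : normedModType R) (f : V -> W)
    (x v : V) (t : R) : derivable f (x + t *: v) v ->
  is_derive t 1 (fun s => f (x + s *: v)) ('D_v f (x + t *: v)).
Proof.
have e : (fun h => h^-1 *: (((fun s => f (x + s *: v)) \o shift t) (h *: 1) -
      f (x + t *: v))) =
    (fun h => h^-1 *: ((f \o shift (x + t *: v)) (h *: v) - f (x + t *: v))).
  apply: funext => h /=; rewrite [_ *: 1]mulr1 scalerDl.
  by rewrite [x + (_ + _)]addrCA.
by move=> df; apply: DeriveDef; rewrite /derivable /derive e.
Qed.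

Lemma MVT_line (R : realType) (V : normedModType R) (f : V -> R)
    (x v : V) (h : R) : 0 <= h -> (forall w, derivable f w v) ->
  exists2 t, t \in `[0, h]%R & f (x + h *: v) - f x = h * 'D_v f (x + t *: v).
Proof.
move=> h0 df.
have dl (t : R) : is_derive t 1 (fun s => f (x + s *: v)) ('D_v f (x + t *: v)).
  exact: is_derive_line.
have [|t th] := @MVT_segment _ _ _ 0 h h0 (fun t _ => dl t).
  apply: continuous_subspaceT => t.
  by apply/differentiable_continuous/derivable1_diffP; case: (dl t).
by rewrite scale0r addr0 subr0 mulrC => ?; exists t.
Qed.

(** The second difference is the increment along [a] of [g w = f (w + h *: b) - f w]. A mean value
    along [a] turns it into an increment of ['D_a f] along [b], to which the mean value theorem
    applies again. *)
Lemma MVT_second_difference (R : realType) (V : normedModType R) (f : V -> R)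
    (x a b : V) (h : R) : 0 <= h ->
  (forall w, derivable f w a) -> (forall w, derivable ('D_a f) w b) ->
  exists s t, [/\ s \in `[0, h]%R, t \in `[0, h]%R &
    f (x + h *: a + h *: b) - f (x + h *: a) - f (x + h *: b) + f x =
      h ^+ 2 * 'D_b ('D_a f) (x + s *: a + t *: b)].
Proof.
move=> h0 dfa dfab; pose g w := f (w + h *: b) - f w.
have dfb w : is_derive w a (fun w => f (w + h *: b)) ('D_a f (w + h *: b)).
  have e : (fun k => k^-1 *: (((fun w => f (w + h *: b)) \o shift w) (k *: a) -
        f (w + h *: b))) =
      (fun k => k^-1 *: ((f \o shift (w + h *: b)) (k *: a) - f (w + h *: b))).
    by apply: funext => k /=; rewrite addrA.
  apply: DeriveDef; rewrite /derivable /derive e //; exact: dfa.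
have dg w : is_derive w a g ('D_a f (w + h *: b) - 'D_a f w).
  by apply: is_deriveB; apply: derivableP.
have [s sh sE] := MVT_line x h0 (fun w => @ex_derive _ _ _ _ _ _ _ (dg w)).
have [t th tE] := MVT_line (x + s *: a) h0 dfab.
exists s, t; split => //.
rewrite -[RHS]mulrA -tE -(@derive_val _ _ _ _ _ _ _ (dg _)) -sE /g; ring.
Qed.

(* Both mixed derivatives are limits of the same second difference quotient. *)
Lemma mixed_derivatives_eq (R : realType) (V : normedModType R) (f : V -> R)
    (x a b : V) :
  (forall w, derivable f w a) -> (forall w, derivable f w b) ->
  (forall w, derivable ('D_a f) w b) -> (forall w, derivable ('D_b f) w a) ->
  {for x, continuous ('D_b ('D_a f))} -> {for x, continuous ('D_a ('D_b f))} ->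
  'D_b ('D_a f) x = 'D_a ('D_b f) x.
Proof.
move=> fa fb fab fba cab cba; apply/eqP; rewrite -subr_eq0 -normr_le0.
apply/ler_addgt0Pl => e e0; rewrite addr0.
have e2 : 0 < e / 2 by rewrite divr_gt0.
have : \forall y \near x, `|'D_b ('D_a f) x - 'D_b ('D_a f) y| < e / 2 /\
    `|'D_a ('D_b f) x - 'D_a ('D_b f) y| < e / 2.
  apply: filterI; first exact: (cvgrPdist_lt _ _).1 cab _ e2.
  exact: (cvgrPdist_lt _ _).1 cba _ e2.
move=> /nbhs_normP[r /= r0 ball_r].
(* This size gives [h * (|a| + |b|) < r], so all mean value points lie in the ball; the [+ 1] keeps
   the denominator positive and the inequality strict. *)
pose h := r / (`|a| + `|b| + 1).
have ab1 : 0 < `|a| + `|b| + 1 by rewrite ltr_wpDl// addr_ge0.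
have h0 : 0 < h by rewrite divr_gt0.
have near_x s t : s \in `[0, h]%R -> t \in `[0, h]%R ->
    ball_ Num.norm x r (x + s *: a + t *: b).
  rewrite !in_itv /= => /andP[s0 sh] /andP[t0 th].
  rewrite -addrA opprD addNKr normrN (le_lt_trans (ler_normD _ _))//.
  rewrite !normrZ !ger0_norm// (@le_lt_trans _ _ (h * (`|a| + `|b|)))//.
    by rewrite mulrDr lerD// ler_wpM2r.
  by rewrite /h mulrAC ltr_pdivrMr// ltr_pM2l// ltrDl.
have [s [t [sh th E1]]] := MVT_second_difference x (ltW h0) fa fab.
have [t' [s' [th' sh' E2]]] := MVT_second_difference x (ltW h0) fb fba.
(* The second difference is symmetric in [a] and [b], so the two mean values agree after division by
   [h ^+ 2]. *)
have E : 'D_b ('D_a f) (x + s *: a + t *: b) =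
         'D_a ('D_b f) (x + s' *: a + t' *: b).
  have h2 : h ^+ 2 != 0 by rewrite gt_eqF// exprn_gt0.
  rewrite [in RHS]addrAC; apply: (mulfI h2).
  apply: (etrans (esym E1)); apply: etrans E2.
  rewrite (addrAC x (h *: b)); ring.
have [B1 _] := ball_r _ (near_x _ _ sh th).
have [_ B2] := ball_r _ (near_x _ _ sh' th').
rewrite distrC in B2; rewrite -E in B2.
rewrite -(subrKA ('D_b ('D_a f) (x + s *: a + t *: b))).
have B12 := ltrD B1 B2; rewrite -splitr in B12.
exact: ltW (le_lt_trans (ler_normD _ _) B12).
Qed.

(** Subtracting the linear term and [M / 2 * s ^+ 2] from [f] along the segment leaves a function
    [g]. A mean value for ['D_v f] shows that its derivative is [s] times a second derivative minus
    [M], hence nonpositive, so [g 1 <= g 0]. *)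
Lemma taylor2_le (R : realType) (V : normedModType R) (f : V -> R)
    (x v : V) (M : R) :
  (forall w, derivable f w v) -> (forall w, derivable ('D_v f) w v) ->
  (forall s, s \in `[0, 1]%R -> 'D_v ('D_v f) (x + s *: v) <= M) ->
  f (x + v) <= f x + 'D_v f x + M / 2.
Proof.
move=> df ddf M_ub.
pose g (s : R) : R := f (x + s *: v) - ('D_v f x *: s + (M / 2) *: s ^+ 2).
have dg (s : R) : is_derive s 1 g ('D_v f (x + s *: v) - ('D_v f x + M * s)).
  have := is_derive_line (df (x + s *: v)) => dl.
  by apply: is_derive_eq; rewrite /GRing.scale /= /GRing.scale /=; field.
have [|s s01] := @MVT_segment _ _ _ 0 1 ler01 (fun t _ => dg t).
  apply: continuous_subspaceT => t.
  by apply/differentiable_continuous/derivable1_diffP; case: (dg t).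
rewrite subr0 mulr1.
have s0 : 0 <= s by move: s01; rewrite in_itv /= => /andP[].
have [t ts tE] := MVT_line x s0 ddf.
have : 'D_v ('D_v f) (x + t *: v) <= M.
  apply: M_ub; move: s01 ts; rewrite !in_itv /= => /andP[_ s1] /andP[-> ts].
  exact: le_trans ts s1.
rewrite /g scale1r scale0r addr0 /GRing.scale /= => le_M gE.
have : s * ('D_v ('D_v f) (x + t *: v)) <= s * M by rewrite ler_wpM2l.
lra.
Qed.

(** * Directional derivatives through the gradient and the Hessian *)

Lemma derive_gradient (R : realType) (n : nat) (f : 'rV[R]_n -> R)
    (w v : 'rV[R]_n) : differentiable f w -> 'D_v f w = dot (gradient f w) v.
Proof.
move=> df; rewrite deriveE// [in LHS](row_sum_delta v) linear_sum.
by apply: eq_bigr => i _; rewrite linearZ /= mxE mulrC deriveE.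
Qed.

Lemma differentiable_partial (R : realType) (n : nat) (f : 'rV[R]_n -> R)
    (w : 'rV[R]_n) (i : 'I_n) :
  differentiable (gradient f) w -> differentiable ('D_(delta_mx 0 i) f) w.
Proof.
move=> dg; have -> : 'D_(delta_mx 0 i) f =
    (fun N : 'rV[R]_n => N 0 i) \o gradient f.
  by apply: funext => y; rewrite /= mxE.
by apply: differentiable_comp => //; exact: differentiable_coord.
Qed.

(** ['D_v f] is a fixed linear combination of the partial derivatives, each of which is
    differentiable as a coordinate of the gradient. *)
Lemma is_derive2_hessian (R : realType) (n : nat) (f : 'rV[R]_n -> R)
    (w v : 'rV[R]_n) : (forall y, differentiable f y) ->
  differentiable (gradient f) w ->
  is_derive w v ('D_v f) ((v *m hessian f w *m v^T) 0 0).
Proof.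
move=> df dg.
have -> : 'D_v f = \sum_(i < n) (v 0 i *: 'D_(delta_mx 0 i) f).
  apply: funext => y; rewrite derive_gradient// fct_sumE.
  by apply: eq_bigr => i _; rewrite mxE mulrC.
have dGi i := differentiable_partial i dg.
have dG i : is_derive w v (v 0 i *: 'D_(delta_mx 0 i) f)
    (v 0 i *: \sum_j hessian f w i j * v 0 j).
  apply: is_deriveZ; apply: DeriveDef; first exact: diff_derivable.
  rewrite derive_gradient//; apply: eq_bigr => j _.
  by rewrite !mxE.
apply: is_derive_eq.
rewrite -mulmxA mxE; apply: eq_bigr => i _; congr (_ * _).
by rewrite mxE; apply: eq_bigr => j _; rewrite !mxE.
Qed.

Lemma continuous_hessian_entry (R : realType) (n : nat) (f : 'rV[R]_n -> R)
    (i j : 'I_n) : continuous (hessian f) ->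
  continuous ('D_(delta_mx 0 j) ('D_(delta_mx 0 i) f)).
Proof.
move=> ch w; have -> : 'D_(delta_mx 0 j) ('D_(delta_mx 0 i) f) =
    (fun N : 'M[R]_n => N i j) \o hessian f.
  by apply: funext => y; rewrite /= mxE.
apply: continuous_comp; first exact: ch.
exact/differentiable_continuous/differentiable_coord.
Qed.

Lemma hessian_sym (R : realType) (n : nat) (f : 'rV[R]_n -> R)
    (w : 'rV[R]_n) : twice_continuously_differentiable f ->
  (hessian f w)^T = hessian f w.
Proof.
move=> [df dg ch]; apply/matrixP => i j; rewrite !mxE.
apply: mixed_derivatives_eq => [y|y|y|y||].
- exact: diff_derivable.
- exact: diff_derivable.
- by apply: diff_derivable; exact: differentiable_partial.
- by apply: diff_derivable; exact: differentiable_partial.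
- exact: continuous_hessian_entry.
- exact: continuous_hessian_entry.
Qed.

(** * Quadratic forms of the Hessian near a point *)

Lemma dot_ge0 (R : realType) (n : nat) (v : 'rV[R]_n) : 0 <= dot v v.
Proof. by apply: sumr_ge0 => i _; rewrite -expr2 sqr_ge0. Qed.

(** Termwise [|v_i v_j| <= (v_i ^+ 2 + v_j ^+ 2) / 2]; summing over all pairs produces the factor
    [n]. *)
Lemma quad_form_le (R : realType) (n : nat) (E : 'M[R]_n) (e : R)
    (v : 'rV[R]_n) : (forall i j, `|E i j| <= e) ->
  (v *m E *m v^T) 0 0 <= n%:R * e * dot v v.
Proof.
move=> Ee; apply: (@le_trans _ _
    (\sum_(i < n) \sum_(j < n) e * ((v 0 i ^+ 2 + v 0 j ^+ 2) / 2))).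
  rewrite -mulmxA mxE; apply: ler_sum => i _.
  rewrite mxE mulr_sumr; apply: ler_sum => j _; rewrite mxE.
  have eE := Ee i j.
  apply: (le_trans (ler_norm _)); rewrite !normrM mulrCA ler_pM//.
  rewrite -[v 0 i ^+ 2]real_normK ?num_real//.
  rewrite -[v 0 j ^+ 2]real_normK ?num_real//.
  have := sqr_ge0 (`|v 0 i| - `|v 0 j|); lra.
rewrite le_eqVlt; apply/orP; left; apply/eqP.
under eq_bigr do rewrite -mulr_sumr -mulr_suml big_split /= sumr_const card_ord.
rewrite -mulr_sumr -mulr_suml big_split /= sumr_const card_ord sumrMnl.
rewrite /dot; under [in RHS]eq_bigr do rewrite -expr2.
set S := \sum_(i < n) v 0 i ^+ 2.
by rewrite -[S *+ n]mulr_natl; field.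
Qed.

(** The Hessian at [y] is the one at [x], controlled by [lambda1], plus a perturbation with small
    entries. The neighbourhood is uniform in [v]. *)
Lemma near_quad_form_hessian_le (R : realType) (n : nat) (f : 'rV[R]_n -> R)
    (x : 'rV[R]_n) (eps : R) : twice_continuously_differentiable f ->
  0 < eps ->
  \forall y \near x, forall v : 'rV[R]_n,
    (v *m hessian f y *m v^T) 0 0 <= (`|lambda1 (hessian f x)| + eps) * dot v v.
Proof.
move=> C2 eps0; have [_ _ ch] := C2.
(* Dividing by [n.+1] covers [n = 0] and still absorbs the factor [n] of [quad_form_le]. *)
have e0 : 0 < eps / n.+1%:R by rewrite divr_gt0.
have near_e : \forall y \near x, `|hessian f x - hessian f y| < eps / n.+1%:R.
  exact: (cvgrPdist_lt _ _).1 (ch x) _ e0.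
apply: filterS near_e => y y_e v.
rewrite -[hessian f y](subrK (hessian f x)) mulmxDr mulmxDl mxE addrC mulrDl.
apply: lerD; first by apply: rayleigh_le_lambda1; exact: hessian_sym.
apply: le_trans (quad_form_le (e := eps / n.+1%:R) _ _) _ => [i j|].
  rewrite -[hessian f y - _]opprB mxE normrN; apply: le_trans (ltW y_e).
  rewrite [leRHS]/Num.Def.normr /= mx_normrE.
  exact: (le_bigmax _
    (fun ij => `|(hessian f x - hessian f y) ij.1 ij.2|) (i, j)).
rewrite ler_wpM2r ?dot_ge0// mulrCA -[leRHS]mulr1 ler_wpM2l ?ltW//.
by rewrite ltr_pdivrMr// mul1r ltr_nat.
Qed.

Lemma gradient_descent_lemma (R : realType) (n : nat) (f : 'rV[R]_n -> R)
    (y v : 'rV[R]_n) (M : R) : twice_continuously_differentiable f ->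
  (forall s, s \in `[0, 1]%R ->
    (v *m hessian f (y + s *: v) *m v^T) 0 0 <= M * dot v v) ->
  f (y + v) <= f y + dot (gradient f y) v + M / 2 * dot v v.
Proof.
move=> [df dg _] M_ub; rewrite -derive_gradient// mulrAC.
have dd w := is_derive2_hessian v df (dg w).
apply: taylor2_le => [w|w|s s01]; first exact: diff_derivable.
  by case: (dd w).
by case: (dd (y + s *: v)) => _ ->; exact: M_ub.
Qed.

(** * The line search and the lower bound on its steps *)

(** In backtracking, [eta / delta] is the trial just before the accepted one; in forward tracking it
    is the first rejected trial. *)
Lemma line_search_rejected (R : realType) (n : nat) (f : 'rV[R]_n -> R)
    (c delta : R) (w d : 'rV[R]_n) (eta0 Rk eta : R) : 0 < delta ->
  equality_line_search f c delta w d eta0 Rk eta ->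
  ~ accepted f c w d Rk (eta / delta).
Proof.
move=> delta0 [[[|j] [// _ rej _ ->]]|[m [_ rej ->]]].
  have -> : delta ^+ j.+1 * eta0 / delta = delta ^+ j * eta0.
    by rewrite exprSr mulrAC mulfK ?gt_eqF.
  exact: rej.
by rewrite mulrAC -invfM -exprSr.
Qed.

Theorem corollary2p10 (R : realType) (n : nat) (f : 'rV[R]_n -> R)
  (f_C2 : twice_continuously_differentiable f)
  (c delta : R) (c_gt0 : 0 < c) (c_lt1 : c < 1)
  (delta_gt0 : 0 < delta) (delta_lt1 : delta < 1)
  (w : nat -> 'rV[R]_n) (eta eta0 Rref : nat -> R)
  (eta_gt0 : forall k, 0 < eta k)
  (eta0_gt0 : forall k, 0 < eta0 k)
  (Rref_ge : forall k, f (w k) <= Rref k)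
  (eta_search : forall k, equality_line_search f c delta (w k)
     (- gradient f (w k)) (eta0 k) (Rref k) (eta k))
  (w_gd : forall k, w k.+1 = w k - eta k *: gradient f (w k))
  (kbar : nat)
  (f_smooth : forall k, (kbar < k)%N -> segment_smooth f (w k))
  (wstar : 'rV[R]_n) (w_cvg : w k @[k --> \oo] --> wstar) :
  forall eps : R, 0 < eps ->
    exists2 khat : nat, (kbar < khat)%N &
      forall k : nat, (khat <= k)%N ->
        2 * (1 - c) * delta / (`|lambda1 (hessian f wstar)| + eps) <= eta k.
Proof.
move=> eps eps0; set M := `|_| + eps.
have M0 : 0 < M by rewrite ltr_wpDl.
have /nbhs_normP[r /= r0 hess_le] := near_quad_form_hessian_le wstar f_C2 eps0.
(* Two iterates within [rho] of [wstar] differ by less than [2 * rho], so the rejected step is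
   shorter than [2 * rho / delta = r / 2]. Since [rho < r / 4], the whole trial segment stays in the
   ball of radius [r]. *)
pose rho := delta * r / 4.
have rho0 : 0 < rho by rewrite divr_gt0// mulr_gt0.
have rho_lt : rho < r / 4 by rewrite ltr_pM2r// gtr_pMl.
have [N _ w_near] := (cvgrPdist_lt _ _).1 w_cvg _ rho0.
exists (maxn N kbar.+1); first by rewrite leq_maxr.
move=> k; rewrite geq_max => /andP[Nk _].
set g := gradient f (w k).
have [t tE] : exists t, t = eta k / delta by eexists.
have t0 : 0 < t by rewrite tE divr_gt0.
have step_small : `|t *: - g| < r / 2.
  have : `|eta k *: g| < rho + rho.
    have -> : eta k *: g = (wstar - w k.+1) - (wstar - w k).
      by rewrite w_gd !opprB (addrA wstar) subrKA addrAC subrr add0r.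
    by rewrite (le_lt_trans (ler_normB _ _))// ltrD// w_near//= ltnW.
  rewrite !normrZ normrN !gtr0_norm// tE mulrAC ltr_pdivrMr// /rho; lra.
have : f (w k + t *: - g) <=
    f (w k) + dot g (t *: - g) + M / 2 * dot (t *: - g) (t *: - g).
  apply: gradient_descent_lemma => // s; rewrite in_itv /= => /andP[s0 s1].
  apply: hess_le => /=; rewrite opprD addrA.
  apply: le_lt_trans (ler_normB _ _) _.
  have := w_near k Nk => /= w_k.
  have s_le : `|s *: (t *: - g)| <= `|t *: - g|.
    by rewrite normrZ ger0_norm// ler_piMl.
  apply: lt_trans (ltrD w_k (le_lt_trans s_le step_small)) _; lra.
have /negP := line_search_rejected delta_gt0 (eta_search k).
rewrite -ltNge -/g -tE => rej f_le.
have dotN a b : dot (a *: - g) (b *: - g) = a * b * dot g g.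
  by rewrite /dot mulr_sumr; apply: eq_bigr => i _; rewrite !mxE; ring.
have dotg : dot g (t *: - g) = - (t * dot g g).
  by rewrite /dot mulr_sumr -sumrN; apply: eq_bigr => i _; rewrite !mxE; ring.
have dotg1 : dot g (- g) = - dot g g.
  by rewrite /dot -sumrN; apply: eq_bigr => i _; rewrite !mxE; ring.
move: rej f_le; rewrite dotN dotg dotg1 => rej f_le.
have Rk := Rref_ge k.
(* Rejection bounds the trial value strictly from below, Taylor bounds it from above;
   [Rref k >= f (w k)] lets the two be compared. *)
have pos : 0 < t * dot g g * (M / 2 * t - (1 - c)) by lra.
(* Strictness of [pos] excludes a zero gradient, which permits cancelling the first factor. *)
have tG_gt0 : 0 < t * dot g g.
  rewrite lt_neqAle mulr_ge0 ?dot_ge0 ?ltW// andbT.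
  by apply/eqP => tG0; move: pos; rewrite -tG0 mul0r ltxx.
move: pos; rewrite pmulr_rgt0// => ct.
have -> : eta k = t * delta by rewrite tE divfK// gt_eqF.
rewrite mulrAC ler_pM2r// ler_pdivrMr//; lra.
Qed.
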